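(* For integers $n,j\ge 0$ let $t_{n,j}$ be the number of partial decorated dual skew Dyck paths consisting of $n$ steps and ending on level $j$, and let $G(z,u)=\sum_{n\ge0}\sum_{j\ge0}t_{n,j}z^nu^j$. Then $$G(z,u)=\frac{3z^2-3+\sqrt{1-6z^2+5z^4}}{2z(2-z^2)(u-s_1)},\qquad\text{with}\qquad s_1=\frac{2z}{1+z^2-\sqrt{1-6z^2+5z^4}}.$$ Furthermore, for every $j\ge0$, $$[u^j]G(z,u)=\frac{3z^2-3+\sqrt{1-6z^2+5z^4}}{2(z^2-2)}\,z^jS^{j+1},\qquad\text{with}\qquad S=\frac{1+z^2-\sqrt{1-6z^2+5z^4}}{2z^2}.$$
   Context: A partial decorated dual skew Dyck path is a finite (possibly empty) sequence of steps starting at level $0$, where each step is a black up-step $(1,1)$, a blue up-step $(1,1)$ (each raising the level by 1), or a down-step $(1,-1)$ (lowering the level by 1), such that: the level never becomes negative; a down-step is never immediately followed by a blue up-step; and a blue up-step is never immediately followed by a down-step. (The first step may be a blue up-step.) Its end level is the level reached after its last step (level $0$ for the empty path). $[u^j]$ denotes extraction of the coefficient of $u^j$. The identities are between formal power series; $\sqrt{1-6z^2+5z^4}$ is the power series square root with constant term $1$. Then $S$ is a power series in $z$ with constant term $2$, $1/s_1=zS$ is a power series in $z$ with zero constant term, and $\frac{1}{u-s_1}$ is understood as $-\frac{1}{s_1}\cdot\frac{1}{1-u/s_1}$, expanded in powers of $u/s_1$. *)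

(* Defs.v *)
From HB Require Import structures.
From mathcomp Require Import all_boot all_order all_algebra.
From mathcomp Require Import boolp.

Set Implicit Arguments.
Unset Strict Implicit.
Unset Printing Implicit Defensive.

Import GRing.Theory.
Local Open Scope ring_scope.

Inductive step : predArgType := BlackUp | BlueUp | Down.

Definition nat_of_step (s : step) : nat :=
  match s with BlackUp => 0 | BlueUp => 1 | Down => 2 end.

Definition step_of_nat (n : nat) : option step :=
  match n with 0 => Some BlackUp | 1 => Some BlueUp | 2 => Some Down
             | _ => None end.

Lemma nat_of_stepK : pcancel nat_of_step step_of_nat.
Proof. by case. Qed.

HB.instance Definition _ := Countable.copy step (pcan_type nat_of_stepK).

Lemma step_enumP : Finite.axiom [:: BlackUp; BlueUp; Down].
Proof. by case. Qed.

HB.instance Definition _ := isFinite.Build step step_enumP.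

Definition height (s : step) : int := if s is Down then -1 else 1.

Definition level (p : seq step) : int := \sum_(s <- p) height s.

Definition allowed (s t : step) : bool :=
  match s, t with
  | Down, BlueUp | BlueUp, Down => false
  | _, _ => true
  end.

(* [sorted allowed p] constrains consecutive steps only; it puts no condition
   on the first one. *)
Definition partial_path (p : seq step) : bool :=
  sorted allowed p && [forall i : 'I_(size p).+1, 0 <= level (take i p)].

Definition num_paths (n j : nat) : nat :=
  #|[set p : n.-tuple step | partial_path p && (level p == j%:Z)]|.

Record series (R : Type) := Series { coefs : nat -> R }.

Lemma coefsK R : cancel (@coefs R) (@Series R).
Proof. by case. Qed.

HB.instance Definition _ (R : choiceType) :=
  Choice.copy (series R) (can_type (@coefsK R)).

Lemma seriesP R (f g : series R) :
  (forall n, coefs f n = coefs g n) -> f = g.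
Proof. by case: f g => [f] [g] /= /funext ->. Qed.

Section SeriesRing.
Variable R : comNzRingType.
Implicit Types f g h : series R.

Definition seriesC (c : R) : series R := Series (fun n => if n is 0 then c else 0).
Definition seriesX : series R := Series (fun n => (n == 1)%:R).

Definition series_opp f := Series (fun n => - coefs f n).
Definition series_add f g := Series (fun n => coefs f n + coefs g n).
Definition series_mul f g :=
  Series (fun n => \sum_(i < n.+1) coefs f i * coefs g (n - i)).

Fact series_addA : associative series_add.
Proof. by move=> f g h; apply: seriesP => n /=; rewrite addrA. Qed.
Fact series_addC : commutative series_add.
Proof. by move=> f g; apply: seriesP => n /=; rewrite addrC. Qed.
Fact series_add0 : left_id (seriesC 0) series_add.
Proof. by move=> f; apply: seriesP => -[|n] /=; rewrite add0r. Qed.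
Fact series_addN : left_inverse (seriesC 0) series_opp series_add.
Proof. by move=> f; apply: seriesP => -[|n] /=; rewrite addNr. Qed.

HB.instance Definition _ := GRing.isZmodule.Build (series R)
  series_addA series_addC series_add0 series_addN.

Fact series_mulC : commutative series_mul.
Proof.
move=> f g; apply: seriesP => n /=; rewrite (reindex_inj rev_ord_inj) /=.
by apply: eq_bigr => i _; rewrite subSS subKn ?leq_ord // mulrC.
Qed.

Fact series_mulA : associative series_mul.
Proof.
have mulE f g n : coefs (series_mul f g) n =
    \sum_(i < n.+1) coefs f (n - i) * coefs g i.
  by rewrite series_mulC /=; apply: eq_bigr => i _; rewrite mulrC.
move=> f g h; apply: seriesP => n; rewrite [RHS]mulE /=.
pose coef3 j k := coefs f j * (coefs g (n - j - k) * coefs h k).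
transitivity (\sum_(j < n.+1) \sum_(k < n.+1 | (k <= n - j)%N) coef3 j k).
  apply: eq_bigr => /= j _; have := mulE g h (n - j)%N; rewrite /= => ->.
  by rewrite big_distrr /= (big_ord_narrow_leq (leq_subr _ _)).
rewrite (exchange_big_dep predT) //=; apply: eq_bigr => k _.
transitivity (\sum_(j < n.+1 | (j <= n - k)%N) coef3 j k).
  apply: eq_bigl => j; rewrite -ltnS -(ltnS j) -!subSn ?leq_ord //.
  by rewrite -subn_gt0 -(subn_gt0 j) -!subnDA addnC.
rewrite (big_ord_narrow_leq (leq_subr _ _)) big_distrl /=.
by apply: eq_bigr => j _; rewrite /coef3 -!subnDA addnC mulrA.
Qed.

Fact series_mul1 : left_id (seriesC 1) series_mul.
Proof.
move=> f; apply: seriesP => n /=.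
by rewrite big_ord_recl /= subn0 mul1r big1 ?addr0 // => i _; rewrite mul0r.
Qed.

Fact series_mulDl : left_distributive series_mul series_add.
Proof.
move=> f g h; apply: seriesP => n /=; rewrite -big_split /=.
by apply: eq_bigr => i _; rewrite mulrDl.
Qed.

Fact series_1neq0 : seriesC 1 != 0.
Proof. by apply/eqP => -[/(congr1 (@^~ 0))/eqP]; rewrite oner_eq0. Qed.

HB.instance Definition _ := GRing.Zmodule_isComNzRing.Build (series R)
  series_mulA series_mulC series_mul1 series_mulDl series_1neq0.

Lemma coefs0 n : coefs (0 : series R) n = 0. Proof. by case: n. Qed.
Lemma coefs1 n : coefs (1 : series R) n = (n == 0)%:R. Proof. by case: n. Qed.
Lemma coefsD f g n : coefs (f + g) n = coefs f n + coefs g n.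
Proof. by []. Qed.
Lemma coefsN f n : coefs (- f) n = - coefs f n. Proof. by []. Qed.
Lemma coefsM f g n :
  coefs (f * g) n = \sum_(i < n.+1) coefs f i * coefs g (n - i).
Proof. by []. Qed.

End SeriesRing.

Notation "c %:S" := (seriesC c) (at level 1, format "c %:S") : ring_scope.

(* Series defined by course-of-values recursion: [next [:: a_0; ...; a_(n-1)]]
   is the coefficient a_n. *)
Section Recursion.
Variables (R : nmodType) (next : seq R -> R).

Fixpoint rec_prefix (n : nat) : seq R :=
  if n is m.+1 then rcons (rec_prefix m) (next (rec_prefix m)) else [::].

Definition rec_series : series R := Series (fun n => next (rec_prefix n)).

Lemma rec_prefixE n : rec_prefix n = mkseq (coefs rec_series) n.
Proof. by elim: n => //= n IHn; rewrite mkseqS -IHn. Qed.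

Lemma coefs_rec n :
  coefs rec_series n = next (mkseq (coefs rec_series) n).
Proof. by rewrite -rec_prefixE. Qed.

End Recursion.

Section SeriesUnit.
Variable R : comUnitRingType.
Implicit Types f g : series R.

Definition series_unit : pred (series R) :=
  fun f => coefs f 0 \is a GRing.unit.

Definition series_inv f : series R :=
  if series_unit f then
    rec_series (fun s => (coefs f 0)^-1 *
      ((size s == 0)%:R - \sum_(i < size s) s`_i * coefs f (size s - i)))
  else f.

Fact series_mulV : {in series_unit, left_inverse 1 series_inv *%R}.
Proof.
move=> f fU; have Uf : coefs f 0 \is a GRing.unit by [].
apply: seriesP => n; rewrite coefsM coefs1 big_ord_recr /= subnn.
rewrite [series_inv f]ifT //.
set g := rec_series _; rewrite [X in _ + X * _]coefs_rec size_mkseq.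
rewrite mulrAC mulVr // mul1r addrC; set s := \sum_(i < n) _.
rewrite (_ : \sum_(i < n) _ = s) ?subrK //.
by apply: eq_bigr => i _; rewrite nth_mkseq.
Qed.

Fact series_unitP f g : g * f = 1 -> series_unit f.
Proof.
move=> /(congr1 (fun h => coefs h 0)); rewrite coefsM big_ord1 coefs1 => fg1.
by apply/unitrPr; exists (coefs g 0); rewrite mulrC.
Qed.

Fact series_inv_out : {in [predC series_unit], series_inv =1 id}.
Proof. by move=> f nUf; apply: ifF; apply/negbTE. Qed.

HB.instance Definition _ := GRing.ComNzRing_hasMulInverse.Build (series R)
  series_mulV series_unitP series_inv_out.

Lemma series_unitE f : (f \is a GRing.unit) = (coefs f 0 \is a GRing.unit).
Proof. by []. Qed.

End SeriesUnit.

Section SeriesIdomain.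
Variable R : idomainType.
Implicit Types f g : series R.

Lemma series_neq0 f : f != 0 ->
  exists2 m, coefs f m != 0 & forall i, (i < m)%N -> coefs f i = 0.
Proof.
move=> fn0; have exf : exists m, coefs f m != 0.
  apply: contrapT => nex; case/eqP: fn0; apply: seriesP => n.
  by rewrite coefs0; apply/eqP/negPn/negP => fn; apply: nex; exists n.
exists (ex_minn exf); first by case: ex_minnP.
case: ex_minnP => m _ m_min i; rewrite ltnNge => /negP im.
by apply/eqP/negPn/negP => /m_min.
Qed.

Fact series_integral f g : f * g = 0 -> (f == 0) || (g == 0).
Proof.
move=> fg0; apply/norP => -[/series_neq0[m fm mf] /series_neq0[n gn ng]].
have := congr1 (fun h => coefs h (m + n)%N) fg0; apply/eqP.
have lt_m : (m < (m + n).+1)%N by rewrite ltnS leq_addr.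
rewrite coefs0 coefsM (bigD1 (Ordinal lt_m)) //= addKn big1 ?addr0.
  by rewrite mulf_neq0.
move=> i; rewrite -val_eqE /= neq_ltn => /orP[/mf->|mi]; first by rewrite mul0r.
by rewrite ng ?mulr0 // ltn_subLR ?leq_ord // ltn_add2r.
Qed.

HB.instance Definition _ :=
  GRing.ComUnitRing_isIntegral.Build (series R) series_integral.

(* The square root with constant term 1 of a series with constant term 1. *)
Definition series_sqrt f : series R :=
  rec_series (fun s => if s is [::] then 1 else
    (coefs f (size s) - \sum_(1 <= i < size s) s`_i * s`_(size s - i)) / 2).

Lemma coefs0_sqrt f : coefs (series_sqrt f) 0 = 1.
Proof. by []. Qed.

Lemma coefsS_sqrt f n (g := series_sqrt f) : coefs g n.+1 =
  (coefs f n.+1 - \sum_(1 <= i < n.+1) coefs g i * coefs g (n.+1 - i)) / 2.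
Proof.
rewrite [LHS]coefs_rec -/(series_sqrt f) -/g; set s := mkseq _ _.
transitivity
  ((coefs f (size s) - \sum_(1 <= i < size s) s`_i * s`_(size s - i)) / 2).
  by [].
rewrite size_mkseq; congr ((_ - _) / _); apply: eq_big_nat => i /andP[i1 lt_in].
by rewrite !nth_mkseq // ltn_subrL i1.
Qed.

Lemma sqr_series_sqrt f : 2 \is a @GRing.unit R -> coefs f 0 = 1 ->
  series_sqrt f ^+ 2 = f.
Proof.
move=> U2 f0; apply: seriesP => -[|n]; rewrite expr2 coefsM.
  by rewrite big_ord1 coefs0_sqrt mulr1 f0.
have := coefsS_sqrt f n; have := coefs0_sqrt f.
move: (series_sqrt f) => g /= g0 gS.
rewrite -(big_mkord xpredT (fun i => coefs g i * coefs g (n.+1 - i))).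
rewrite big_nat_recr // big_ltn //= subnn subn0 g0 mulr1 mul1r addrAC.
by rewrite -mulr2n -mulr_natr gS divrK // subrK.
Qed.

Lemma series_sqrt_uniq f g : 2 \is a @GRing.unit R -> coefs f 0 = 1 ->
  g ^+ 2 = f -> coefs g 0 = 1 -> g = series_sqrt f.
Proof.
move=> U2 f0 gf g0; apply/eqP; have /eqP : g ^+ 2 = series_sqrt f ^+ 2.
  by rewrite sqr_series_sqrt.
rewrite eqf_sqr => /orP[//|/eqP gN].
have := congr1 (fun h => coefs h 0) gN; rewrite coefsN coefs0_sqrt g0 => /eqP.
by rewrite -subr_eq0 opprK -[1 + 1]/2 => /eqP U; rewrite U unitr0 in U2.
Qed.

End SeriesIdomain.

Definition series_map (R S : Type) (f : R -> S) (a : series R) : series S :=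
  Series (fun n => f (coefs a n)).

Notation "x %:F" := (FracField.tofrac x) : ring_scope.

(* The field Q((z)) of Laurent series, as the fractions of Q[[z]]. *)
Notation laurent := {fraction (series rat)}.

(* G as an element of Q[[z]][[u]]: the coefficient of u^j is a series in z. *)
Definition path_gf : series (series rat) :=
  Series (fun j => Series (fun n => (num_paths n j)%:R)).

(* G as an element of Q((z))[[u]], where u - c is invertible for each nonzero
   Laurent series c; its inverse is the expansion of -c^-1 / (1 - u / c). *)
Definition G : series laurent := series_map (fun a => a%:F) path_gf.

(* Main.v *)
(** Decompose by the last step. If [A_j], [B_j], [D_j] count the paths ending on
    level [j] with a black up-step (or empty), a blue up-step and a down-step,
    then [A_0 = 1], [B_0 = 0], and
      [A_{j+1} = z (A_j + B_j + D_j)], [B_{j+1} = z (A_j + B_j)],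
      [D_j = z (A_{j+1} + D_{j+1})],
    which determines all three series coefficientwise in [z]. Since
    [z^2 S^2 - (1 + z^2) S + 2 - z^2 = 0], the solution is
      [A_{j+1} = z (S - 1) (z S)^j], [B_{j+1} = z (z S)^j],
      [D_j = (S - 2) (z S)^j],
    so the paths ending on level [j] have generating series [(S - 1) (z S)^j],
    and [G] is a geometric series in [u]. *)
Require Import Defs.
From mathcomp Require Import all_boot all_order all_algebra.
From mathcomp Require Import ring.
Import GRing.Theory.
Local Open Scope ring_scope.

(** * Coefficients of formal power series *)

Lemma coefsXM (R : comNzRingType) (f : series R) n :
  coefs (seriesX R * f) n = if n is m.+1 then coefs f m else 0.
Proof.
rewrite coefsM; case: n => [|n]; first by rewrite big_ord1 mul0r.
rewrite !big_ord_recl /= mul0r add0r mul1r subSS subn0 big1 ?addr0 // => i _.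
by rewrite mul0r.
Qed.

Lemma coefsCM (R : comNzRingType) (c : R) (f : series R) n :
  coefs (c%:S * f) n = c * coefs f n.
Proof.
by rewrite coefsM big_ord_recl /= subn0 big1 ?addr0 // => i _; rewrite mul0r.
Qed.

Lemma coefs_nat (R : comNzRingType) m n :
  coefs (m%:R : series R) n = if n is 0 then m%:R else 0.
Proof.
elim: m => [|m IHm]; first by rewrite coefs0; case: n.
by rewrite -addn1 !natrD coefsD IHm coefs1; case: n {IHm} => [|n]; rewrite ?addr0.
Qed.

Lemma series_nat_neq0 m : m.+1%:R != 0 :> series rat.
Proof.
apply/eqP => /(congr1 (fun f => coefs f 0)) /eqP.
by rewrite coefs0 coefs_nat Num.Theory.pnatr_eq0.
Qed.

Lemma seriesX_neq0 (R : comNzRingType) : seriesX R != 0.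
Proof.
by apply/eqP => /(congr1 (fun f => coefs f 1)) /eqP; rewrite coefs0 oner_eq0.
Qed.

(** Division by $z^2$, which is not a unit among power series; this is how S is obtained as a power
    series and not merely a Laurent series. *)
Lemma seriesX2_dvd (R : comNzRingType) (f : series R) :
  coefs f 0 = 0 -> coefs f 1 = 0 ->
  f = seriesX R ^+ 2 * Series (fun n => coefs f n.+2).
Proof.
by move=> f0 f1; apply: seriesP => -[|[|n]]; rewrite expr2 -mulrA !coefsXM.
Qed.

Lemma big_step (P : pred step) (F : step -> nat) : (\sum_(t | P t) F t =
  (if P BlackUp then F BlackUp else 0) + (if P BlueUp then F BlueUp else 0)
  + (if P Down then F Down else 0))%N.
Proof.
rewrite big_mkcond (perm_big [:: BlackUp; BlueUp; Down]).
  by rewrite !big_cons big_nil /= addn0 addnA.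
by apply: uniq_perm => [||[]]; rewrite ?index_enum_uniq ?mem_index_enum.
Qed.

(** * Counting paths by their last step *)

Section LastStep.
Implicit Types (s t : step) (p q : seq step).

Lemma level_rcons p s : level (rcons p s) = level p + height s.
Proof. by rewrite /level -cats1 big_cat big_seq1. Qed.

Lemma partial_path_level p : partial_path p -> 0 <= level p.
Proof. by case/andP=> _ /forallP/(_ ord_max); rewrite /= take_size. Qed.

(* The default [BlackUp] of [last] may precede every step, as the empty path
   may. *)
Lemma partial_path_rcons p s : partial_path (rcons p s) =
  [&& partial_path p, allowed (last BlackUp p) s & 0 <= level p + height s].
Proof.
have -> : partial_path (rcons p s) = [&& sorted allowed p,
    allowed (last BlackUp p) s, [forall i : 'I_(size p).+1, 0 <= level (take i p)]
    & 0 <= level p + height s].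
  rewrite /partial_path [RHS]andbA; congr (_ && _).
    by case: p => [|x p] /=; rewrite ?rcons_path //; case: s.
  apply/forallP/andP => [ge0|[/forallP ge0 ge0s] i].
    split; last by rewrite -level_rcons -[rcons p s]take_size; apply: (ge0 ord_max).
    apply/forallP => i.
    have lt_i : (i < (size (rcons p s)).+1)%N by rewrite size_rcons ltnS ltnW.
    have := ge0 (Ordinal lt_i); rewrite /= -cats1 takel_cat //.
    by rewrite -ltnS.
  have := ltn_ord i; rewrite ltnS leq_eqVlt => /orP[/eqP ->|].
    by rewrite take_size level_rcons.
  move: (nat_of_ord i) => {}i; rewrite size_rcons => lt_i; rewrite -cats1 takel_cat //.
  exact: (ge0 (Ordinal lt_i)).
by rewrite /partial_path -!andbA; congr (_ && _); rewrite andbCA.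
Qed.

(** The default of [last] files the empty path under [BlackUp], in agreement with $A_0 = 1$. *)
Definition num_last s n (j : nat) : nat :=
  #|[set p : n.-tuple step |
     [&& partial_path p, level p == j%:Z & last BlackUp p == s]]|.

Lemma num_lastP (P : pred step) n (j : nat) :
  #|[set p : n.-tuple step |
     [&& partial_path p, level p == j%:Z & P (last BlackUp p)]]| =
  (\sum_(t | P t) num_last t n j)%N.
Proof.
rewrite -sum1dep_card (partition_big (fun p : n.-tuple step => last BlackUp p) P).
  apply: eq_bigr => t Pt; rewrite /num_last -sum1dep_card; apply: eq_bigl => p.
  by rewrite -!andbA; case: (last _ _ =P t) => [->|_]; rewrite ?Pt ?andbF.
by move=> p /and3P[].
Qed.

Lemma num_paths_last n j : num_paths n j =
  (num_last BlackUp n j + num_last BlueUp n j + num_last Down n j)%N.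
Proof.
transitivity (\sum_(t | xpredT t) num_last t n j)%N.
  by rewrite -num_lastP; apply: eq_card => p; rewrite !inE andbT.
by rewrite big_step.
Qed.

Lemma num_last0 s j : num_last s 0 j = ((s == BlackUp) && (j == 0))%N.
Proof.
have pp0 : partial_path [::].
  by apply/forallP => i; rewrite /level big_nil.
rewrite /num_last; set A := [set _ | _].
have -> : A = if (s == BlackUp) && (j == 0)%N then [set [tuple]] else set0.
  apply/setP => p; rewrite tuple0 !inE /= pp0 /level big_nil /=.
  by rewrite eq_sym eqz_nat (eq_sym BlackUp) andbC; case: ifP; rewrite inE ?eqxx.
by case: ifP; rewrite ?cards1 ?cards0.
Qed.

(** Appending [s] is a bijection from the tuples of length [n] onto the tuples of length [n.+1] that
    end with [s]. *)
Lemma num_last_rcons s n j : num_last s n.+1 j =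
  #|[set p : n.-tuple step |
     partial_path (rcons p s) && (level (rcons p s) == j%:Z)]|.
Proof.
pose f (p : n.-tuple step) : n.+1.-tuple step := [tuple of rcons p s].
have f_inj : injective f.
  by move=> p q /(congr1 val) /= /rcons_inj[] /val_inj.
rewrite -(card_imset _ f_inj); apply: eq_card => p; rewrite inE.
apply/and3P/imsetP => [[pp lv /eqP ls]|[q]].
  case pE: {-1}(tval p) / (lastP (tval p)) => [|q x].
    by have := size_tuple p; rewrite pE.
  move: pp lv ls; rewrite pE last_rcons => pp lv xs; subst x.
  have szq : size q == n by rewrite -eqSS -(size_rcons q s) -pE size_tuple.
  by exists (Tuple szq); [rewrite inE pp | apply: val_inj].
by rewrite inE => /andP[pp lv] ->; rewrite /= last_rcons.
Qed.

(** The level before the final up-step would be -1. *)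
Lemma num_last_up0 s n : s != Down -> num_last s n.+1 0 = 0%N.
Proof.
move=> sU; rewrite num_last_rcons; apply/eqP; rewrite cards_eq0; apply/eqP/setP.
move=> p; rewrite !inE partial_path_rcons level_rcons; apply/negbTE/negP.
case/andP=> /and3P[/partial_path_level lv _ _].
by case: s sU => // _; case: (level p) lv => // m _; rewrite -PoszD addn1.
Qed.

(** The final level [j.+1] already settles the sign condition of [partial_path_rcons], so only the
    rule on consecutive steps is left. *)
Lemma num_last_upS s n j : s != Down ->
  num_last s n.+1 j.+1 = (\sum_(t | allowed t s) num_last t n j)%N.
Proof.
move=> sU; rewrite num_last_rcons -(num_lastP (allowed^~ s)).
apply: eq_card => p; rewrite !inE partial_path_rcons level_rcons.
have -> : height s = 1 by case: s sU.
rewrite -[j.+1]addn1 PoszD (inj_eq (addIr _)).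
case pp: (partial_path p) => //=; case: eqP => [->|]; last by rewrite !andbF.
by rewrite -PoszD !andbT.
Qed.

Lemma num_last_down n j :
  num_last Down n.+1 j = (\sum_(t | allowed t Down) num_last t n j.+1)%N.
Proof.
rewrite num_last_rcons -(num_lastP (allowed^~ Down)).
apply: eq_card => p; rewrite !inE partial_path_rcons level_rcons /=.
rewrite subr_eq -PoszD addn1.
case pp: (partial_path p) => //=; case: eqP => [->|]; last by rewrite !andbF.
by rewrite -addn1 PoszD addrK !andbT.
Qed.

End LastStep.

(** * Closed forms solving the recurrences *)

Section Solution.
Variable s : series rat.
Notation z := (seriesX rat).
Hypothesis s_eq : s - 2 = z ^+ 2 * (s ^+ 2 - s - 1).

Definition last_sol t j : series rat :=
  match t, j with
  | BlackUp, 0 => 1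
  | BlackUp, i.+1 => z * ((s - 1) * (z * s) ^+ i)
  | BlueUp, 0 => 0
  | BlueUp, i.+1 => z * (z * s) ^+ i
  | Down, _ => (s - 2) * (z * s) ^+ j
  end.

Lemma last_sol_black j : last_sol BlackUp j.+1 =
  z * (last_sol BlackUp j + last_sol BlueUp j + last_sol Down j).
Proof. by case: j => [|j] /=; rewrite ?exprS; ring. Qed.

Lemma last_sol_blue j :
  last_sol BlueUp j.+1 = z * (last_sol BlackUp j + last_sol BlueUp j).
Proof. by case: j => [|j] /=; rewrite ?exprS; ring. Qed.

(** This is where the quadratic equation enters: up to the common factor [(z * s) ^+ j], the claim
    is $s - 2 = z^2 (s - 1) + z^2 s (s - 2)$. *)
Lemma last_sol_down j :
  last_sol Down j = z * (last_sol BlackUp j.+1 + last_sol Down j.+1).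
Proof. by rewrite /= {1}s_eq !exprS; ring. Qed.

(** Each recurrence carries a factor [z], so its coefficients at [n.+1] come from those at [n]; at
    [n = 0] every constant coefficient vanishes except that of [last_sol BlackUp 0]. *)
Lemma coefs_last_sol n t j : coefs (last_sol t j) n = (num_last t n j)%:R.
Proof.
elim: n t j => [|n IHn] t j.
  rewrite num_last0; case: t => [||].
  - by case: j => [|j]; rewrite ?coefs1 // last_sol_black coefsXM.
  - by case: j => [|j]; rewrite ?coefs0 // last_sol_blue coefsXM.
  - by rewrite last_sol_down coefsXM.
case: t => [||].
- case: j => [|j]; first by rewrite num_last_up0 // coefs1.
  by rewrite last_sol_black coefsXM !coefsD !IHn num_last_upS // big_step /= !natrD.
- case: j => [|j]; first by rewrite num_last_up0 // coefs0.
  rewrite last_sol_blue coefsXM !coefsD !IHn num_last_upS // big_step /= addn0.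
  by rewrite natrD.
- rewrite last_sol_down coefsXM !coefsD !IHn num_last_down big_step /= addn0.
  by rewrite natrD.
Qed.

Lemma coefs_path_gf j : coefs path_gf j = (s - 1) * (z * s) ^+ j.
Proof.
transitivity (last_sol BlackUp j + last_sol BlueUp j + last_sol Down j).
  by apply: seriesP => n; rewrite !coefsD !coefs_last_sol -!natrD -num_paths_last.
by case: j => [|j] /=; rewrite ?exprS; ring.
Qed.

End Solution.

(** * The power series S and its quadratic equation *)

Lemma sqrt_quadratic
    (w := series_sqrt (1 - 6 * seriesX rat ^+ 2 + 5 * seriesX rat ^+ 4)) :
  exists s, [/\ s != 0, w = 1 + seriesX rat ^+ 2 - 2 * seriesX rat ^+ 2 * s
    & s - 2 = seriesX rat ^+ 2 * (s ^+ 2 - s - 1)].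
Proof.
set z := seriesX rat in w *.
have half2 : 2 * (2^-1)%:S = 1 :> series rat.
  by apply: seriesP => n; rewrite mulrC coefsCM coefs_nat coefs1; case: n => [|n].
have z2 n : coefs (z ^+ 2) n = (n == 2%N)%:R.
  by rewrite expr2 coefsXM; case: n => [|n].
have disc0 : coefs (1 - 6 * z ^+ 2 + 5 * z ^+ 4) 0 = 1.
  rewrite (_ : _ + _ = 1 + z * (5 * z ^+ 3 - 6 * z)); last by ring.
  by rewrite coefsD coefsXM.
have w1 : coefs w 1 = 0.
  rewrite coefsS_sqrt big_geq // subr0.
  rewrite (_ : _ + _ = 1 + z * (z * (5 * z ^+ 2 - 6))); last by ring.
  by rewrite coefsD coefsXM coefsXM /= addr0 mul0r.
have w2 : w ^+ 2 = 1 - 6 * z ^+ 2 + 5 * z ^+ 4 by apply: sqr_series_sqrt.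
have w0 : coefs w 0 = 1 by exact: coefs0_sqrt.
move: w w0 w1 w2 => w w0 w1 w2.
(* [f] is $z^2 S$. Its coefficients of degree 0 and 1 vanish, so shifting by two gives the witness
   [s], which is S. *)
pose f := (2^-1)%:S * (1 + z ^+ 2 - w).
have fE : f = z ^+ 2 * Series (fun n => coefs f n.+2).
  apply: seriesX2_dvd; rewrite coefsCM coefsD coefsN coefsD coefs1 z2 /=.
    by rewrite w0 addr0 subrr mulr0.
  by rewrite w1 addr0 subrr mulr0.
move: (Series _) fE => s fE; exists s.
have wE : w = 1 + z ^+ 2 - 2 * z ^+ 2 * s.
  by rewrite -mulrA -fE /f mulrA half2; ring.
have sE : s - 2 = z ^+ 2 * (s ^+ 2 - s - 1).
  (* Substituting [wE] into [w2] gives the equation multiplied by $4z^2$, a factor to be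
     cancelled. *)
  have z20 : 2 * 2 * z ^+ 2 != 0.
    by rewrite !mulf_neq0 ?expf_neq0 ?seriesX_neq0 // series_nat_neq0.
  apply: (mulfI z20); apply/eqP; rewrite -subr_eq0; apply/eqP.
  transitivity (1 - 6 * z ^+ 2 + 5 * z ^+ 4 - w ^+ 2); first by rewrite wE; ring.
  by rewrite w2 subrr.
(* The right-hand side of [sE] has constant coefficient 0, while [s = 0] would make that of the
   left-hand side -2. *)
split=> //; apply/eqP => s0; move: sE; rewrite s0 expr2 -mulrA.
move=> /(congr1 (fun g => coefs g 0)).
by rewrite coefsXM coefsD coefsN coefs_nat coefs0.
Qed.

(** * Geometric series and identities over a field *)

(** The sum is $k / (1 - r u) = -(k/r) / (u - 1/r)$; the fraction is expanded by [c] to reach the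
    denominator of the theorem. *)
Lemma gf_geometric (F : fieldType) (g : series F) (k c r : F) :
  c != 0 -> r != 0 -> (forall j, coefs g j = k * r ^+ j) ->
  g = (- (k * c / r))%:S / (c%:S * (seriesX F - r^-1%:S)).
Proof.
move=> c0 r0 gE; set d := c%:S * _.
(* Inversion leaves non-units unchanged, so the quotient has its intended meaning only because the
   constant coefficient $-c/r$ of [d] is nonzero. *)
have Ud : d \is a GRing.unit.
  rewrite series_unitE coefsCM coefsD coefsN unitfE.
  by rewrite mulf_neq0 ?add0r ?oppr_eq0 ?invr_eq0.
apply: (mulIr Ud); rewrite divrK //; apply: seriesP => n.
have -> : g * d = c%:S * (seriesX F * g - r^-1%:S * g) by rewrite /d; ring.
rewrite coefsCM coefsD coefsN coefsXM coefsCM gE.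
by case: n => [|n]; rewrite ?gE ?exprS /=; field.
Qed.

(** With [t] for S, the first two identities recover $S$ and $s_1 = 1/(zS)$; the last two match the
    prefactors of the theorem with the coefficients $(S - 1)(zS)^j$. *)
Lemma quadratic_field (F : fieldType) (z w t : F) :
  2 != 0 :> F -> z != 0 -> t != 0 -> 2 - z ^+ 2 != 0 ->
  w = 1 + z ^+ 2 - 2 * z ^+ 2 * t -> t - 2 = z ^+ 2 * (t ^+ 2 - t - 1) ->
  [/\ (1 + z ^+ 2 - w) / (2 * z ^+ 2) = t,
      2 * z / (1 + z ^+ 2 - w) = (z * t)^-1,
      3 * z ^+ 2 - 3 + w = - ((t - 1) * (2 * z * (2 - z ^+ 2)) / (z * t))
    & forall j, (3 * z ^+ 2 - 3 + w) / (2 * (z ^+ 2 - 2)) * z ^+ j * t ^+ j.+1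
        = (t - 1) * (z * t) ^+ j].
Proof.
move=> two0 z0 t0 z2 wE tE.
have numE : 3 * z ^+ 2 - 3 + w = - ((t - 1) * (2 * z * (2 - z ^+ 2)) / (z * t)).
  apply/eqP; rewrite -subr_eq0; apply/eqP.
  (* Once [w] is eliminated, the two sides differ by the quadratic relation times [2 / t]. *)
  transitivity (2 / t * (t - 2 - z ^+ 2 * (t ^+ 2 - t - 1))).
    by rewrite wE; field; rewrite t0 z0.
  by rewrite -tE subrr mulr0.
split=> //.
- by rewrite wE; field; rewrite two0 z0.
- rewrite (_ : 1 + _ - w = 2 * z * (z * t)); last by rewrite wE; ring.
  by field; rewrite two0 z0 t0.
- move=> j; rewrite numE exprMn (exprS t); move: (z ^+ j) (t ^+ j) => a b.
  by field; rewrite t0 z0 two0 -[_ - 2]opprB oppr_eq0 z2.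
Qed.

Theorem theorem2 :
  let z : laurent := (seriesX rat)%:F in
  let u : series laurent := seriesX laurent in
  let w : laurent :=
    (series_sqrt (1 - 6 * seriesX rat ^+ 2 + 5 * seriesX rat ^+ 4))%:F in
  let s1 : laurent := 2 * z / (1 + z ^+ 2 - w) in
  let S : laurent := (1 + z ^+ 2 - w) / (2 * z ^+ 2) in
  G = (3 * z ^+ 2 - 3 + w)%:S / ((2 * z * (2 - z ^+ 2))%:S * (u - s1%:S))
  /\ forall j : nat,
       coefs G j =
         (3 * z ^+ 2 - 3 + w) / (2 * (z ^+ 2 - 2)) * z ^+ j * S ^+ j.+1.
Proof.
move=> z u w s1 S.
have [s [s0 wE sE]] := sqrt_quadratic.
pose t : laurent := s%:F.
have wt : w = 1 + z ^+ 2 - 2 * z ^+ 2 * t.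
  by rewrite /w wE !(rmorphB, rmorphD, rmorphM, rmorphXn, rmorph1, rmorph_nat).
have tE : t - 2 = z ^+ 2 * (t ^+ 2 - t - 1).
  have := congr1 (@FracField.tofrac _) sE.
  by rewrite !(rmorphB, rmorphM, rmorphXn, rmorph1, rmorph_nat).
have t0 : t != 0 by rewrite tofrac_eq0.
have z0 : z != 0 by rewrite tofrac_eq0 seriesX_neq0.
have two0 : 2 != 0 :> laurent.
  by rewrite -(rmorph_nat (@FracField.tofrac _)) tofrac_eq0 series_nat_neq0.
have z2 : 2 - z ^+ 2 != 0.
  rewrite -(rmorph_nat (@FracField.tofrac _)) -rmorphXn -rmorphB tofrac_eq0.
  apply/eqP => /(congr1 (fun g => coefs g 0)) /eqP.
  by rewrite coefsD coefsN coefs_nat coefs0 expr2 coefsXM subr0.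
have GE j : coefs G j = (t - 1) * (z * t) ^+ j.
  rewrite -[LHS]/((coefs path_gf j)%:F) (coefs_path_gf s sE).
  by rewrite !(rmorphB, rmorphM, rmorphXn, rmorph1).
have [SE s1E numE coefE] := quadratic_field _ z w t two0 z0 t0 z2 wt tE.
split=> [|j].
  have c0 : 2 * z * (2 - z ^+ 2) != 0 := mulf_neq0 (mulf_neq0 two0 z0) z2.
  have r0 : z * t != 0 := mulf_neq0 z0 t0.
  (* The series has first term [t - 1] and ratio [z * t], the inverse of [s1]; [numE] identifies the
     numerator. *)
  by rewrite (gf_geometric _ _ _ _ _ c0 r0 GE) /s1 s1E numE.
by rewrite /S SE coefE GE.
Qed.
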